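(* Let $f\in\mathcal{D}([a,b])$ be a function all of whose jumps are of the same sign and are summable, and let $h>0$. Then $$\omega^{(M_1)}_h(f)\leq\omega^{(U)}_h(f_{\mathrm{c.}}),$$ where $f_{\mathrm{c.}}$ is the continuous part of $f$.
   Context: $[a,b]\subset\mathbb{R}$ is a compact interval and $\mathcal{D}([a,b])$ is the space of càdlàg functions on $[a,b]$ (right-continuous with left limits; following Skorokhod, also left-continuous at $b$). The jump of $f$ at $t$ is $f(t)-f(t-)$, and $J_f$ is the (at most countable) set of discontinuity points of $f$. The jumps are summable if $\sum_{t\in J_f}|f(t)-f(t-)|<+\infty$. In that case $f$ decomposes as the sum of a continuous part $f_{\mathrm{c.}}$ and a pure jump part, where (up to an additive constant, which is irrelevant here) $f_{\mathrm{c.}}(u)=f(u)-\sum_{t\in J_f,\,t\leq u}(f(t)-f(t-))$. For real $x,y,c$, $d(c;[x,y])$ is the distance between $c$ and the closed interval with endpoints $x$ and $y$ (that is, $[y,x]$ if $y<x$). The moduli of continuity are $$\omega^{(M_1)}_h(f)=\sup_{u,u',u''\in[a,b]:\,u-h\leq u'\leq u\leq u''\leq u+h}d\bigl(f(u);[f(u'),f(u'')]\bigr),\qquad \omega^{(U)}_h(g)=\sup_{u,u'\in[a,b]:\,|u-u'|\leq h}|g(u)-g(u')|.$$ *)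

(* Defs.v *)
From HB Require Import structures.
From mathcomp Require Import all_boot all_order all_algebra.
From mathcomp Require Import all_classical all_reals all_analysis.

Set Implicit Arguments.
Unset Strict Implicit.
Unset Printing Implicit Defensive.

Import Order.TTheory GRing.Theory Num.Theory.
Import numFieldNormedType.Exports.

Local Open Scope classical_set_scope.
Local Open Scope ring_scope.

(* A function on [a, b] is represented by a total function R -> R, whose values
   outside [a, b] are irrelevant: the moduli, the cadlag property and the
   discontinuity set only see [a, b], and for cadlag functions jumps are only
   taken at points of ]a, b[. *)

Section Skorokhod.
Context {R : realType}.
Implicit Types (a b h t u c x y : R) (f g : R -> R).

(* With Skorokhod's convention of left-continuity at b.  The one-sided
   conditions are only imposed where the corresponding side lies in [a, b],
   so every function is cadlag on [a, a]. *)
Definition cadlag a b f : Prop :=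
  [/\ forall t, a <= t < b -> f x @[x --> t^'+] --> f t,
      forall t, a < t <= b -> cvg (f x @[x --> t^'-]) &
      a < b -> f x @[x --> b^'-] --> f b].

(* Discontinuities of f as a function on [a, b]. For a cadlag function this set
   is contained in ]a, b[, so that jump below is always a genuine two-sided
   jump. *)
Definition discontinuities a b f : set R :=
  [set t | t \in `[a, b] /\ ~ f x @[x --> within `[a, b] (nbhs t)] --> f t].

Definition jump f t : R := f t - lim (f x @[x --> t^'-]).

Definition jumps_same_sign a b f : Prop :=
  (forall t, discontinuities a b f t -> 0 <= jump f t) \/
  (forall t, discontinuities a b f t -> jump f t <= 0).

Definition jumps_summable a b f : Prop :=
  summable (discontinuities a b f) (EFin \o jump f).

(* Unordered sum of an absolutely summable real family; esum computes
   unordered sums of nonnegative families only. *)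
Definition signed_sum (D : set R) (k : R -> R) : R :=
  fine (\esum_(t in D) (EFin \o k)^\+ t - \esum_(t in D) (EFin \o k)^\- t)%E.

Definition continuous_part a b f u : R :=
  f u - signed_sum (discontinuities a b f `&` [set t | t <= u]) (jump f).

Definition dist_interval c x y : \bar R :=
  edist_inf `[Num.min x y, Num.max x y]%classic c.

Definition modulus_M1 a b h f : \bar R :=
  ereal_sup [set d | exists u u' u'' : R,
    [/\ [/\ u \in `[a, b], u' \in `[a, b] & u'' \in `[a, b]],
        u - h <= u' <= u, u <= u'' <= u + h &
        d = dist_interval (f u) (f u') (f u'')]].

Definition modulus_U a b h g : \bar R :=
  ereal_sup [set d | exists u u' : R,
    [/\ u \in `[a, b], u' \in `[a, b], `|u - u'| <= h &
        d = `|g u - g u'|%:E]].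

End Skorokhod.

(* Main.v *)
(** Write [f = f_c + J] with [J] the jump part. If all jumps are nonnegative
    (resp. nonpositive) then [J] is monotone, so for [u' <= u <= u''] the value
    [f u] can leave the interval between [f u'] and [f u''] only by an amount
    that [f_c] moves on [[u', u]] or on [[u, u'']]. *)
Require Import Defs.
From HB Require Import structures.
From mathcomp Require Import all_boot all_order all_algebra.
From mathcomp Require Import all_classical all_reals all_analysis.
From mathcomp Require Import lra.
Import Order.TTheory GRing.Theory Num.Theory.
Import numFieldNormedType.Exports.
Local Open Scope classical_set_scope.
Local Open Scope ring_scope.

(** [edist] is an infimum over radii of open balls, so [|x - y|] itself need not be admissible, but
    each [|x - y| + e] with [e > 0] is. *)
Lemma edist_le_norm (R : realType) (x y : R) : (edist (x, y) <= `|x - y|%:E)%E.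
Proof.
apply/lee_addgt0Pr => e e0; rewrite -EFinD; apply: edist_fin => /=.
  by rewrite ltr_wpDl.
by rewrite /ball /= ltrDl.
Qed.

Lemma dist_interval_le (R : realType) (c x y w : R) :
  0 <= w -> Num.min x y - w <= c -> c <= Num.max x y + w ->
  (dist_interval c x y <= w%:E)%E.
Proof.
(* [z] is the projection of [c] onto the interval; the two bounds on [c] place it within [w] of
   [z]. *)
move=> w0 lo hi; pose z := Num.max (Num.min x y) (Num.min c (Num.max x y)).
have minmax : Num.min x y <= Num.max x y by rewrite ge_min le_max lexx.
have zin : z \in `[Num.min x y, Num.max x y].
  rewrite in_itv /= /z; move: minmax; move: (Num.min x y) (Num.max x y) => m M.
  by rewrite le_max ge_max ge_min !lexx orbT => ->.
have cz : `|c - z| <= w.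
  rewrite /z; move: minmax lo hi.
  move: (Num.min x y) (Num.max x y) => m M mM lo hi.
  case: (leP c M) => cM; case: (leP m _) => mc; rewrite ler_norml; lra.
apply: ge_ereal_inf; exists (edist (c, z)); first by exists z.
by rewrite (le_trans (edist_le_norm _ _ _))// lee_fin.
Qed.

Lemma subset_esum (R : realType) (T : choiceType) (A B : set T)
    (k : T -> \bar R) :
  A `<=` B -> (forall t, B t -> 0 <= k t)%E ->
  (\esum_(t in A) k t <= \esum_(t in B) k t)%E.
Proof.
(* The sum over [A] becomes a sum over [B] whose terms outside [A] are 0. *)
move=> AB k0; rewrite -(setIidr AB) esum_mkcondr; apply: le_esum => t Bt.
by case: ifP => // _; exact: k0.
Qed.

(** With a single sign one half of the difference vanishes. The other is written with absolute
    values because that is the sum which [summable] makes finite. *)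
Lemma signed_sum_ge0 (R : realType) (D : set R) (k : R -> R) :
  (forall t, D t -> 0 <= k t) ->
  signed_sum D k = fine (\esum_(t in D) `|(k t)%:E|)%E.
Proof.
move=> k0; rewrite /signed_sum; congr fine.
rewrite [X in (_ - X)%E]esum1 ?sube0 => [|t Dt].
  apply: eq_esum => t Dt; rewrite funeposE /= ger0_norm ?k0//.
  by rewrite max_l // lee_fin k0.
by rewrite funenegE /= max_r // lee_fin oppr_le0 k0.
Qed.

Lemma signed_sum_le0 (R : realType) (D : set R) (k : R -> R) :
  (forall t, D t -> k t <= 0) ->
  signed_sum D k = - fine (\esum_(t in D) `|(k t)%:E|)%E.
Proof.
move=> k0; rewrite /signed_sum -fineN; congr fine.
rewrite [X in (X - _)%E]esum1 ?sub0e => [|t Dt]; last first.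
  by rewrite funeposE /= max_r // lee_fin k0.
congr (- _)%E; apply: eq_esum => t Dt; rewrite funenegE /= ler0_norm ?k0//.
by rewrite max_l // lee_fin oppr_ge0 k0.
Qed.

Lemma fine_esum_nondecreasing (R : realType) (D : set R) (k : R -> R) :
  summable D (EFin \o k) ->
  {homo (fun u => fine (\esum_(t in D `&` [set t | (t <= u)%R]) `|(k t)%:E|)%E) :
    u v / u <= v}.
Proof.
move=> sk u v uv.
(* [fine] sends infinities to 0, so it preserves order only once both sums are known to be
   finite. *)
have fin w : (\esum_(t in D `&` [set t | (t <= w)%R]) `|(k t)%:E|)%E \is a fin_num.
  rewrite ge0_fin_numE ?esum_ge0//; apply: le_lt_trans sk.
  by apply: subset_esum => // t [].
apply: fine_le => //; apply: subset_esum => // t [Dt tu].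
by split => //; exact: le_trans tu uv.
Qed.

(** Up to a global sign, the jump part at [u] is the total size of the jumps in a set that grows
    with [u]. *)
Lemma jump_part_monotone (R : realType) (a b : R) (f : R -> R) :
  let J u :=
    signed_sum (discontinuities a b f `&` [set t | t <= u]) (jump f) in
  jumps_same_sign a b f -> jumps_summable a b f ->
  {homo J : u v / u <= v} \/ {homo J : u v /~ u <= v}.
Proof.
move=> J [k0|k0] sk; [left|right] => u v uv; rewrite /J.
  rewrite !signed_sum_ge0 => [|t [/k0]//|t [/k0]//].
  exact: fine_esum_nondecreasing.
rewrite !signed_sum_le0 ?lerN2 => [|t [/k0]//|t [/k0]//].
exact: fine_esum_nondecreasing.
Qed.

Lemma modulus_U_ge (R : realType) (a b h : R) (g : R -> R) (u v : R) :
  u \in `[a, b] -> v \in `[a, b] -> `|u - v| <= h ->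
  (`|g u - g v|%:E <= modulus_U a b h g)%E.
Proof. by move=> ua va uv; apply: ereal_sup_ubound; exists u, v. Qed.

Theorem theorem18 (R : realType) (a b : R) (f : R -> R) (h : R)
    (ab : a <= b) (f_cadlag : cadlag a b f)
    (f_sign : jumps_same_sign a b f) (f_summable : jumps_summable a b f)
    (h_gt0 : 0 < h) :
  (modulus_M1 a b h f <= modulus_U a b h (continuous_part a b f))%E.
Proof.
apply: ge_ereal_sup => _ [u [u' [u'' [[ui u'i u''i] /andP[hu' u'u]
  /andP[uu'' u''h] ->]]]].
set g := continuous_part a b f.
(* A real bound on both increments: [modulus_U] is an extended real, while the final inequalities
   are linear arithmetic over [R]. *)
pose w := Num.max `|g u - g u'| `|g u - g u''|.
have wU : (w%:E <= modulus_U a b h g)%E.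
  rewrite /w; case: (leP `|g u - g u'|) => _; apply: modulus_U_ge => //;
    by rewrite ler_norml; lra.
apply: le_trans wU.
have : `|g u - g u'| <= w by rewrite /w le_max lexx.
have : `|g u - g u''| <= w by rewrite /w le_max lexx orbT.
move: w => w; rewrite !ler_norml /g /continuous_part.
have [J_mono|J_mono] := jump_part_monotone _ _ _ _ f_sign f_summable.
all: have := J_mono _ _ u'u; have := J_mono _ _ uu''.
all: set J := signed_sum _ _; set J' := signed_sum _ _.
all: set J'' := signed_sum _ _ => JJ'' J'J /andP[h1 h2] /andP[h3 h4].
all: apply: dist_interval_le; first lra.
(* For a nondecreasing jump part, [f u' - w <= f u <= f u'' + w]; for a nonincreasing one,
   [f u'' - w <= f u <= f u' + w]. The case split only evaluates the minimum and maximum. *)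
all: case: (leP (f u') (f u'')) => ?; lra.
Qed.
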